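(* Let $n\ge 2$ and let $\hat\alpha=\bar X^2/S^2$ be the moment estimator of the shape parameter $\alpha$ based on a random sample $X_1,\dots,X_n$ from the gamma distribution with shape $\alpha>0$ and scale $\lambda>0$. Then the estimator $1/\hat\alpha$ is not dispersively monotone in $\alpha$; that is, $1/\hat\alpha$ is neither increasing nor decreasing in $\alpha$ with respect to the dispersive order $\leq_{\mathrm{disp}}$.
   Context: The gamma distribution with shape $\alpha>0$ and scale $\lambda>0$ has density $f(x;\alpha,\lambda)=\frac{1}{\Gamma(\alpha)\lambda^{\alpha}}x^{\alpha-1}e^{-x/\lambda}$, $x>0$. A random sample is a collection of independent identically distributed random variables. For a sample $X_1,\dots,X_n$, $\bar X=\frac1n\sum_{i=1}^n X_i$ is the sample mean and $S^2=\frac1n\sum_{i=1}^n (X_i-\bar X)^2$ is the biased sample variance. For random variables $X,Y$ with distribution functions $F,G$ and quantile functions $F^{-1},G^{-1}$, $X\leq_{\mathrm{disp}}Y$ means that $F^{-1}(v)-F^{-1}(u)\le G^{-1}(v)-G^{-1}(u)$ for all $0<u<v<1$. A statistic $\hat\theta$ whose law depends on $\theta$ is increasing (respectively decreasing) in $\theta$ with respect to an order $\prec$ if $\hat\theta_1\prec\hat\theta_2$ (respectively $\hat\theta_2\prec\hat\theta_1$) whenever $\theta_1<\theta_2$, where $\hat\theta_i$ is the statistic based on a sample from the distribution with parameter $\theta_i$. Here the parameter $\theta$ is $\alpha\in(0,\infty)$. *)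

(* Defs.v *)
From HB Require Import structures.
From mathcomp Require Import all_boot all_order all_algebra.
From mathcomp Require Import all_classical all_reals all_analysis.
From mathcomp Require Import measurable_realfun.

Set Implicit Arguments.
Unset Strict Implicit.
Unset Printing Implicit Defensive.

Import Order.TTheory GRing.Theory Num.Theory.
Import numFieldNormedType.Exports.

Local Open Scope classical_set_scope.
Local Open Scope ring_scope.

Section gamma_distribution.
Context {R : realType}.
Implicit Types a l x : R.

(* \int without %E is the real-valued Lebesgue integral; the integrand is
   integrable for a > 0. *)
Definition Gamma a : R :=
  \int[lebesgue_measure]_(x in `]0, +oo[) (x `^ (a - 1) * expR (- x)).

Definition gamma_pdf a l x : R :=
  if 0 < x then (Gamma a * l `^ a)^-1 * x `^ (a - 1) * expR (- (x / l)) else 0.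

End gamma_distribution.

Section random_sample.
Context {R : realType} {d : measure_display} {T : measurableType d}.
Variable P : probability T R.

Definition has_gamma_law (a l : R) (X : {RV P >-> R}) : Prop :=
  forall A : set R, measurable A ->
    (distribution P X A =
     \int[lebesgue_measure]_(x in A) (gamma_pdf a l x)%:E)%E.

Definition mutually_independent (I : finType) (X : I -> {RV P >-> R}) : Prop :=
  forall (J : {set I}) (B : I -> set R), (forall i, measurable (B i)) ->
    P (\bigcap_(i in [set` J]) X i @^-1` B i) =
    (\prod_(i in J) P (X i @^-1` B i))%E.

Definition gamma_sample (n : nat) (a l : R) (X : 'I_n -> {RV P >-> R}) : Prop :=
  mutually_independent X /\ forall i, has_gamma_law a l (X i).

End random_sample.

Arguments has_gamma_law {R d T} P a l X.
Arguments mutually_independent {R d T} P {I} X.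
Arguments gamma_sample {R d T} P {n} a l X.

Section moment_estimator.
Context {R : realType} {d : measure_display} {T : measurableType d} {n : nat}.
Variable X : 'I_n -> {mfun T >-> R}.

Definition sample_mean (t : T) : R := n%:R^-1 * \sum_(i < n) X i t.

Definition sample_variance (t : T) : R :=
  n%:R^-1 * \sum_(i < n) (X i t - sample_mean t) ^+ 2.

(* Where the sample variance vanishes (a null event for n >= 2 and a gamma
   sample) the convention x / 0 = 0 applies. *)
Definition alpha_hat (t : T) : R := sample_mean t ^+ 2 / sample_variance t.

Definition inv_alpha_hat (t : T) : R := (alpha_hat t)^-1.

Lemma measurable_inv_alpha_hat : measurable_fun [set: T] inv_alpha_hat.
Proof.
have mV : measurable_fun [set: R] (@GRing.inv R).
  have -> : @GRing.inv R = fun x => if x == 0 then 0 else x^-1.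
    by apply/funext => x; case: eqP => // ->; rewrite invr0.
  apply: measurable_fun_if => //.
    apply: (measurable_fun_bool true).
    rewrite setTI [Z in measurable Z](_ : _ = [set 0]).
      exact: measurable_set1.
    by apply/seteqP; split => x /eqP.
  rewrite setTI [Z in measurable_fun Z _](_ : _ = [set x : R | x != 0]);
      last by apply/seteqP; split => x /=; case: eqP.
  apply: open_continuous_measurable_fun; first exact: open_neq.
  by move=> x; rewrite inE => /inv_continuous.
have mmean : measurable_fun [set: T] sample_mean.
  apply: measurable_funM => //; exact: measurable_sum.
apply: (measurableT_comp mV); apply: measurable_funM.
  exact: measurable_funX.
apply: (measurableT_comp mV); apply: measurable_funM => //.
apply: measurable_sum => i; apply: measurable_funX.
exact: measurable_funB.
Qed.

HB.instance Definition _ :=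
  isMeasurableFun.Build _ _ T R inv_alpha_hat measurable_inv_alpha_hat.

End moment_estimator.

Section dispersive_order.
Context {R : realType}.

(* The generalized inverse F^-1(u) = inf {x | u <= F x}; for 0 < u < 1 the set is
   nonempty and bounded below, so that inf is its genuine infimum. *)
Definition quantile (d : measure_display) (T : measurableType d)
    (P : probability T R) (X : {RV P >-> R}) (u : R) : R :=
  inf [set x : R | (u%:E <= cdf (P := P) X x)%E].
Arguments quantile {d T} P X u.

Definition disp_le (d1 d2 : measure_display)
    (T1 : measurableType d1) (T2 : measurableType d2)
    (P1 : probability T1 R) (P2 : probability T2 R)
    (X : {RV P1 >-> R}) (Y : {RV P2 >-> R}) : Prop :=
  forall u v : R, 0 < u -> u < v -> v < 1 ->
    quantile P1 X v - quantile P1 X u <= quantile P2 Y v - quantile P2 Y u.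
Arguments disp_le {d1 d2 T1 T2} P1 P2 X Y.

(* A statistic depending on a parameter in (0, +oo) is a family of random
   variables indexed by that parameter, each on its own probability space. *)
Section monotone.
Context {d : {posnum R} -> measure_display}
  {T : forall a, measurableType (d a)}.
Variable P : forall a, probability (T a) R.
Variable Y : forall a, {RV (P a) >-> R}.

Definition disp_increasing : Prop :=
  forall a1 a2 : {posnum R}, a1%:num < a2%:num ->
    disp_le (P a1) (P a2) (Y a1) (Y a2).

Definition disp_decreasing : Prop :=
  forall a1 a2 : {posnum R}, a1%:num < a2%:num ->
    disp_le (P a2) (P a1) (Y a2) (Y a1).

End monotone.

End dispersive_order.

Arguments disp_increasing {R d T} P Y.
Arguments disp_decreasing {R d T} P Y.

(* Main.v *)
Require Import Defs.
From HB Require Import structures.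
From mathcomp Require Import all_boot all_order all_algebra.
From mathcomp Require Import all_classical all_reals all_analysis.
From mathcomp Require Import measurable_realfun ring lra.

Set Implicit Arguments.
Unset Strict Implicit.
Unset Printing Implicit Defensive.

Import Order.TTheory GRing.Theory Num.Theory.
Import numFieldNormedType.Exports.

Local Open Scope classical_set_scope.
Local Open Scope ring_scope.

(** Writing W = 1 / alpha_hat = n (sum X_i^2) / (sum X_i)^2 - 1, the law of W
    lives on [0, n - 1] and charges every neighbourhood of both endpoints,
    whatever the shape.  Two laws with the same extreme points that are ordered
    dispersively, in either direction, have the same quantiles.  So monotonicity
    would force W to have the same law for the shapes 1 and 2n.  But W > n - 1 - e^2
    makes some ratio X_j / X_i at most e^2, hence some X_i outside ]e, 1/e], which
    for the shape 2n has probability O(e^(2n-1)), whereas for the shape 1 the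
    event W > n - 1 - e^2/2 has probability at least a multiple of e^(2n-2). *)

(** * Pointwise bounds on [1 / alpha_hat] *)

Section moment_ratio.
Context {R : realType} {d : measure_display} {T : measurableType d} {n : nat}.
Variables (X : 'I_n -> {mfun T >-> R}) (t : T).
Hypothesis n_ge2 : (2 <= n)%N.
Implicit Types (e : R) (i j : 'I_n).

Let S := \sum_i X i t.
Let Q := \sum_i X i t ^+ 2.

Let n_gt0 : 0 < n%:R :> R. Proof. by rewrite ltr0n; case: n n_ge2. Qed.

Let other_index i : exists j, j != i.
Proof.
have [->|i1] := eqVneq i (Ordinal n_ge2); first by exists (Ordinal (ltnW n_ge2)).
by exists (Ordinal n_ge2); rewrite eq_sym.
Qed.

(** Expanding the squares gives [Q - S ^+ 2 / n%:R] for the sum of squared deviations. Since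
    inversion fixes 0, a vanishing variance yields the value 0, as the formula does. *)
Lemma inv_alpha_hatE : S != 0 -> inv_alpha_hat X t = n%:R * Q / S ^+ 2 - 1.
Proof.
move=> S0; rewrite /inv_alpha_hat /alpha_hat invf_div /sample_variance.
have -> : \sum_i (X i t - sample_mean X t) ^+ 2 = Q - S ^+ 2 / n%:R.
  under eq_bigr do rewrite sqrrB.
  rewrite big_split sumrB /= -/Q sumrMnl -mulr_suml -/S sumr_const card_ord.
  rewrite /sample_mean -/S -(mulr_natr _ n) -(mulr_natr _ 2).
  by field; rewrite gt_eqF.
rewrite /sample_mean -/S; field.
by rewrite S0 gt_eqF.
Qed.

Lemma inv_alpha_hat_ge0 : 0 <= inv_alpha_hat X t.
Proof.
rewrite /inv_alpha_hat /alpha_hat invf_div divr_ge0 ?sqr_ge0// mulr_ge0//.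
by rewrite sumr_ge0// => i _; exact: sqr_ge0.
Qed.

Let le_inv_alpha_hatE e : 0 < S ->
  (inv_alpha_hat X t <= n%:R - 1 - e) = (e * S ^+ 2 <= n%:R * (S ^+ 2 - Q)).
Proof.
move=> S0; rewrite inv_alpha_hatE ?gt_eqF//.
rewrite -subr_ge0 -[RHS]subr_ge0 -(pmulr_lge0 _ (exprn_gt0 2 S0)).
by congr (0 <= _); field; rewrite gt_eqF.
Qed.

Let S_gt i : (forall j, 0 < X j t) -> X i t < S.
Proof.
move=> X0; have [j ji] := other_index i.
rewrite /S (bigD1 i)//= (bigD1 j)//= ltrDl ltr_pwDl//.
by rewrite sumr_ge0// => k _; exact: ltW.
Qed.

(** The right side is the sum of the cross products [X i t * X j t] with [i != j]; by
    [le_inv_alpha_hatE] they control the gap between the statistic and [n%:R - 1]. *)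
Let sqrB_sum : S ^+ 2 - Q = \sum_i X i t * (S - X i t).
Proof.
under eq_bigr do rewrite mulrBr -expr2.
by rewrite sumrB -mulr_suml expr2.
Qed.

Lemma inv_alpha_hat_le_pos :
  (forall i, 0 < X i t) -> inv_alpha_hat X t <= n%:R - 1.
Proof.
move=> X0; have S0 : 0 < S.
  exact: lt_trans (X0 (Ordinal n_ge2)) (S_gt _ X0).
rewrite -[leRHS]subr0 le_inv_alpha_hatE// mul0r mulr_ge0 ?(ltW n_gt0)// sqrB_sum.
by rewrite sumr_ge0// => i _; rewrite mulr_ge0 ?(ltW (X0 _))// subr_ge0 ltW ?S_gt.
Qed.

(** The upper bounds give [Q <= (1 + e) * S], and [n%:R <= S] then bounds [n%:R * Q / S ^+ 2] by
    [1 + e]. *)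
Lemma inv_alpha_hat_le_near_diagonal e : 0 < e ->
  (forall i, 1 <= X i t <= 1 + e) -> inv_alpha_hat X t <= e.
Proof.
move=> e0 X1; have Sn : n%:R <= S.
  rewrite -[n in n%:R]card_ord -sumr_const; apply: ler_sum => i _.
  by case/andP: (X1 i).
have S0 : 0 < S by exact: lt_le_trans Sn.
have QS : Q <= (1 + e) * S.
  rewrite mulr_sumr; apply: ler_sum => i _.
  have /andP[? ?] := X1 i; rewrite expr2 ler_wpM2r//; lra.
rewrite inv_alpha_hatE ?gt_eqF// lerBlDr ler_pdivrMr ?exprn_gt0//.
have -> : (e + 1) * S ^+ 2 = S * ((1 + e) * S) by ring.
by apply: ler_pM => //; apply: sumr_ge0 => i _; exact: sqr_ge0.
Qed.

(** With [y = X i t] and [u = n%:R * e], one has [y ^+ 2 <= Q] and [S <= y * (1 + u)], which reduces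
    the claim to [(1 - 2 * u) * (1 + u) ^+ 2 <= 1]. *)
Lemma inv_alpha_hat_ge_near_axis i e : 0 < e -> 1 <= X i t ->
  (forall j, j != i -> 0 <= X j t <= e) ->
  n%:R - 1 - 2 * n%:R ^+ 2 * e <= inv_alpha_hat X t.
Proof.
move=> e0 X1 Xe; have Sge : X i t <= S.
  by rewrite /S (bigD1 i)//= lerDl sumr_ge0// => j /Xe/andP[].
have S0 : 0 < S by lra.
have Sle : S <= X i t * (1 + n%:R * e).
  rewrite /S (bigD1 i)//= mulrDr mulr1 lerD2l.
  apply: (@le_trans _ _ (\sum_(j < n) e)).
    rewrite [leRHS](bigD1 i)//= ler_wpDl ?(ltW e0)//.
    by apply: ler_sum => j /Xe/andP[].
  rewrite sumr_const card_ord -[e *+ n]mulr_natl ler_peMl// mulr_ge0//; exact: ltW.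
have Qge : X i t ^+ 2 <= Q.
  by rewrite /Q (bigD1 i)//= lerDl sumr_ge0// => j _; exact: sqr_ge0.
rewrite inv_alpha_hatE ?gt_eqF//.
suff : n%:R * (1 - 2 * (n%:R * e)) <= n%:R * Q / S ^+ 2.
  have -> : n%:R - 1 - 2 * n%:R ^+ 2 * e = n%:R * (1 - 2 * (n%:R * e)) - 1.
    by ring.
  by move=> h; rewrite lerB.
rewrite -mulrA ler_pM2l// ler_pdivlMr ?exprn_gt0//.
apply: le_trans Qge.
have u0 : 0 < n%:R * e by rewrite mulr_gt0.
set u := n%:R * e in Sle u0 *; set y := X i t in Sle Sge X1 *.
have [u1|u1] := leP (1 - 2 * u) 0.
  apply: (@le_trans _ _ 0); last exact: sqr_ge0.
  by rewrite mulr_le0_ge0// sqr_ge0.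
apply: (@le_trans _ _ ((1 - 2 * u) * (y * (1 + u)) ^+ 2)).
  by rewrite ler_pM2l// lerXn2r// nnegrE; lra.
rewrite exprMn mulrCA ler_piMr ?sqr_ge0//.
have : 0 <= u ^+ 3 by rewrite exprn_ge0// ltW.
have : 0 <= u ^+ 2 by rewrite sqr_ge0.
have -> : (1 - 2 * u) * (1 + u) ^+ 2 = 1 - 3 * u ^+ 2 - 2 * u ^+ 3 by ring.
lra.
Qed.

(** After clearing denominators the claim holds term by term in [i]: [e ^+ 2 * S <= n%:R * e]
    because [S <= n%:R / e], and [e <= S - X i t] because another coordinate exceeds [e]. *)
Lemma inv_alpha_hat_le_away_from_axes e : 0 < e ->
  (forall i, e < X i t <= e^-1) -> inv_alpha_hat X t <= n%:R - 1 - e ^+ 2.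
Proof.
move=> e0 Xe; have X0 i : 0 < X i t by have /andP[/(lt_trans e0)] := Xe i.
have S0 : 0 < S.
  exact: lt_trans (X0 (Ordinal n_ge2)) (S_gt _ X0).
have Sle : S <= n%:R * e^-1.
  rewrite mulr_natl -[in leRHS](card_ord n) -sumr_const; apply: ler_sum => i _.
  by case/andP: (Xe i).
rewrite le_inv_alpha_hatE// sqrB_sum expr2 -[S ^+ 2]/(S * S) {2}/S.
rewrite mulr_suml !mulr_sumr.
apply: ler_sum => i _; rewrite [leLHS]mulrCA [leRHS]mulrCA ler_pM2l//.
apply: (@le_trans _ _ (n%:R * e)).
  have -> : n%:R * e = e * e * (n%:R * e^-1) by field; rewrite gt_eqF.
  by rewrite ler_pM2l ?mulr_gt0.
rewrite ler_pM2l//.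
have [j ji] := other_index i.
rewrite /S (bigD1 i)//= addrAC subrr add0r (bigD1 j)//=.
rewrite ler_wpDr ?sumr_ge0//; last by case/andP: (Xe j) => /ltW.
by move=> k _; exact: ltW.
Qed.

End moment_ratio.

(** * Dispersive order between laws with the same extreme points *)

Section full_range.
Context {R : realType}.

(** In other words, 0 and [m] are the least and the greatest point of the support. *)
Definition full_range (m : R) d (T : measurableType d) (P : probability T R)
    (X : {RV P >-> R}) :=
  [/\ forall x, x < 0 -> cdf X x = 0%E, cdf X m = 1%E,
      forall e, 0 < e -> (0 < cdf X e)%E & forall e, 0 < e -> (cdf X (m - e) < 1)%E].

Section quantile.
Context {m : R} {d : measure_display} {T : measurableType d}.
Context {P : probability T R} {X : {RV P >-> R}}.
Hypothesis fX : full_range m X.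

Lemma quantile_le u x : 0 < u -> (u%:E <= cdf X x)%E -> quantile X u <= x.
Proof.
move=> u0 ux; apply: ge_inf ux; exists 0 => y /= uy.
rewrite leNgt; apply/negP => y0; move: uy.
by have [/(_ y y0) -> _ _ _] := fX; rewrite lee_fin leNgt u0.
Qed.

Lemma quantile_ge u x : u < 1 -> (cdf X x < u%:E)%E -> x <= quantile X u.
Proof.
move=> u1 xu; apply: lb_le_inf.
  by exists m => /=; have [_ Xm _ _] := fX; rewrite Xm lee_fin ltW.
move=> y /= uy; rewrite leNgt; apply/negP => yx.
have := lt_le_trans xu uy; rewrite ltNge => /negP; apply.
exact/cdf_nondecreasing/ltW.
Qed.

Lemma quantile_ge0 u : 0 < u -> u < 1 -> 0 <= quantile X u.
Proof.
move=> u0 u1; apply/ler_addgt0Pr => e e0.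
rewrite -lerBlDr sub0r; apply: quantile_ge => //.
by have [/(_ (- e)) Xe _ _ _] := fX; rewrite Xe ?oppr_lt0 ?lte_fin.
Qed.

Lemma quantile_le_max u : 0 < u -> u < 1 -> quantile X u <= m.
Proof.
move=> u0 u1; apply: quantile_le => //.
by have [_ Xm _ _] := fX; rewrite Xm lee_fin ltW.
Qed.

End quantile.

(** Supplies a real level for [quantile] between two extended-real values of [cdf]. *)
Lemma ereal_fin_between (x y : \bar R) : (0 <= x)%E -> (x < y)%E -> (y <= 1)%E ->
  exists2 u : R, (0 < u < 1) & (x < u%:E < y)%E.
Proof.
move: x y => [x| |] [y| |]//; rewrite !lee_fin lte_fin => x0 xy y1.
by exists ((x + y) / 2); rewrite ?lte_fin; apply/andP; split; lra.
Qed.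

Section two_variables.
Context {m : R} {d1 d2 : measure_display}.
Context {T1 : measurableType d1} {T2 : measurableType d2}.
Context {P1 : probability T1 R} {P2 : probability T2 R}.
Context {X : {RV P1 >-> R}} {Y : {RV P2 >-> R}}.
Hypotheses (fX : full_range m X) (fY : full_range m Y).

(* Letting one argument of the dispersive inequality tend to 0 or to 1 compares
   the quantiles themselves, in opposite directions. *)
Lemma disp_le_quantile_eq : disp_le X Y ->
  forall u, 0 < u < 1 -> quantile X u = quantile Y u.
Proof.
move=> XY u /andP[u0 u1]; apply/eqP; rewrite eq_le; apply/andP; split.
  apply/ler_addgt0Pr => e e0.
  have [_ _ /(_ _ e0) Xe _] := fX.
  have [v /andP[v0 v1] /andP[_ ve]] := ereal_fin_between (lexx 0%E) Xe (cdf_le1 _ _).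
  (* Being at most [v] puts the [w]-quantile of [X] below [e]; being below [u] makes [XY] applicable
     to [w] and [u]. *)
  pose w := Num.min v (u / 2).
  have w0 : 0 < w by rewrite lt_min v0 divr_gt0.
  have wu : w < u by rewrite gt_min; apply/orP; right; lra.
  have wv : w <= v by rewrite ge_min lexx.
  have := XY w u w0 wu u1.
  have : quantile X w <= e.
    by apply: (quantile_le fX) => //; apply: le_trans (ltW ve); rewrite lee_fin.
  have := quantile_ge0 fY w0 (lt_trans wu u1); lra.
apply/ler_addgt0Pr => e e0.
have [_ _ _ /(_ _ e0) Xe] := fX.
have [v /andP[v0 v1] /andP[ve _]] := ereal_fin_between (cdf_ge0 _ _) Xe (lexx 1%E).
pose w := Num.max v ((u + 1) / 2).
have w1 : w < 1 by rewrite gt_max v1/=; lra.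
have uw : u < w by rewrite lt_max; apply/orP; right; lra.
have vw : v <= w by rewrite le_max lexx.
have := XY u w u0 uw w1.
have : m - e <= quantile X w.
  by apply: (quantile_ge fX) => //; apply: lt_le_trans ve _; rewrite lee_fin.
have := quantile_le_max fY (lt_trans u0 uw) w1; lra.
Qed.

(** Otherwise a level strictly between the two values would have an [X]-quantile at least [y] and a
    [Y]-quantile at most [x]. The gap [x < y] replaces continuity of the distribution functions. *)
Lemma quantile_eq_cdf_le :
  (forall u, 0 < u < 1 -> quantile X u = quantile Y u) ->
  forall x y, x < y -> (cdf Y x <= cdf X y)%E.
Proof.
move=> XY x y xy; rewrite leNgt; apply/negP => YX.
have [u u01 /andP[Xu uY]] := ereal_fin_between (cdf_ge0 _ _) YX (cdf_le1 _ _).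
have /andP[u0 u1] := u01.
have := quantile_ge fX u1 Xu.
by rewrite XY// leNgt (le_lt_trans (quantile_le fY u0 (ltW uY))).
Qed.

End two_variables.

End full_range.

(** * Densities and interval probabilities of gamma laws *)

Section gamma_law.
Context {R : realType}.
Implicit Types (l x : R) (k : nat).

Lemma gamma_pdf_ge0 (a l x : R) : 0 <= gamma_pdf a l x.
Proof.
rewrite /gamma_pdf; case: ifP => // x0.
rewrite !mulr_ge0 ?expR_ge0 ?powR_ge0// invr_ge0 mulr_ge0 ?powR_ge0//.
by apply: Rintegral_ge0 => y _; rewrite mulr_ge0 ?expR_ge0 ?powR_ge0.
Qed.

Lemma measurable_gamma_pdf (a l : R) : measurable_fun setT (gamma_pdf a l).
Proof.
rewrite /gamma_pdf; apply: measurable_fun_ifT => //.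
  exact: measurable_fun_ltr.
apply: measurable_funM.
  by apply: measurable_funM => //; exact: measurable_powR.
apply: measurableT_comp => //; apply: measurableT_comp => //.
exact: measurable_funM.
Qed.

(** The normalizing constant at shape [k + 1], where the density carries the ordinary power
    [x ^+ k]. *)
Definition gamma_coef k l : R := (Gamma k.+1%:R * l `^ k.+1%:R)^-1.

Lemma gamma_pdf_natE k l x : 0 < x ->
  gamma_pdf k.+1%:R l x = gamma_coef k l * x ^+ k * expR (- (x / l)).
Proof.
move=> x0; rewrite /gamma_pdf x0 -/(gamma_coef k l) -natr1 addrK.
by rewrite powR_mulrn// ltW.
Qed.

Lemma gamma_coef_ge0 k l : 0 <= gamma_coef k l.
Proof.
rewrite invr_ge0 mulr_ge0 ?powR_ge0//.
by apply: Rintegral_ge0 => y _; rewrite mulr_ge0 ?expR_ge0 ?powR_ge0.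
Qed.

Section law.
Context {d : measure_display} {T : measurableType d} {P : probability T R}.
Context {X : {RV P >-> R}} {a l : R}.
Hypothesis lawX : has_gamma_law P a l X.

Let mpdf b (A : set R) : measurable_fun A (fun x => (gamma_pdf b l x)%:E).
Proof.
apply/measurable_EFinP; exact: measurable_funTS (measurable_gamma_pdf _ _).
Qed.

Lemma gamma_law_ge_density (r s t : R) : 0 <= r -> s < t ->
  (forall x, s <= x <= t -> r <= gamma_pdf a l x) ->
  ((r * (t - s))%:E <= P (X @^-1` `[s, t]))%E.
Proof.
move=> r0 st rpdf; have := lawX (measurable_itv `[s, t]).
rewrite /distribution /pushforward => ->.
have -> : ((r * (t - s))%:E = \int[lebesgue_measure]_(x in `[s, t]) cst r%:E x)%E.
  by rewrite integral_cst//= lebesgue_measure_itv/= lte_fin st -EFinB EFinM.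
by apply: ge0_le_integral => //=; exact: mpdf.
Qed.

Lemma gamma_law_gt0 : P (X @^-1` `]0, +oo[) = 1%E.
Proof.
have : P (X @^-1` `]-oo, 0]) = 0%E.
  have := lawX (measurable_itv `]-oo, 0]).
  rewrite /distribution /pushforward => ->.
  apply: integral0_eq => x /=; rewrite in_itv/= => x0.
  by rewrite /gamma_pdf ltNge x0.
move=> P0; rewrite -setCitvl preimage_setC probability_setC ?P0 ?sube0//.
exact: (measurable_funPTI X (measurable_itv `]-oo, 0])).
Qed.

(** Integrating the domination leaves [C] times the probability that [Y] lies in [A], which is at
    most 1. *)
Lemma gamma_law_le {d'} {T' : measurableType d'} {P' : probability T' R}
    (Y : {RV P' >-> R}) b (C : R) (A : set R) : has_gamma_law P' b l Y ->
  measurable A -> 0 <= C ->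
  (forall x, A x -> gamma_pdf a l x <= C * gamma_pdf b l x) ->
  (P (X @^-1` A) <= C%:E)%E.
Proof.
move=> lawY mA C0 ab; have := lawX mA.
rewrite /distribution /pushforward => ->.
apply: (@le_trans _ _
  (\int[lebesgue_measure]_(x in A) (C%:E * (gamma_pdf b l x)%:E))%E).
  apply: ge0_le_integral => //=.
  - by move=> x _; rewrite lee_fin gamma_pdf_ge0.
  - exact: mpdf.
  - by apply: measurable_funeM; exact: mpdf.
rewrite ge0_integralZl_EFin//; last 2 first.
- by move=> x _; rewrite lee_fin gamma_pdf_ge0.
- exact: mpdf.
rewrite -lawY// muleC gee_pMl ?lee_fin//; last exact: probability_le1.
exact: fin_num_measure.
Qed.

End law.

Section law_nat.
Context {d : measure_display} {T : measurableType d} {P : probability T R}.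
Context {X : {RV P >-> R}} {k : nat} {l : R}.
Hypothesis lawX : has_gamma_law P k.+1%:R l X.

(** A zero coefficient would make the density vanish, against total mass 1; no value of [Gamma] is
    computed. *)
Lemma gamma_coef_gt0 : 0 < gamma_coef k l.
Proof.
rewrite lt_def gamma_coef_ge0 andbT; apply/eqP => c0; have := lawX measurableT.
rewrite /distribution /pushforward preimage_setT probability_setT integral0_eq.
  by move/eqP; rewrite onee_eq0.
move=> x _; have [x0|x0] := ltP 0 x.
  by rewrite gamma_pdf_natE// c0 !mul0r.
by rewrite /gamma_pdf ltNge x0.
Qed.

(** On [[s, t]] the power is smallest at [s] and the exponential at [t]. *)
Lemma gamma_law_itv_ge (s t : R) : 0 < l -> 0 < s -> s < t ->
  ((gamma_coef k l * s ^+ k * expR (- (t / l)) * (t - s))%:E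
    <= P (X @^-1` `[s, t]))%E.
Proof.
move=> l0 s0 st; apply: (gamma_law_ge_density lawX) => //.
  by rewrite !mulr_ge0 ?expR_ge0 ?(ltW gamma_coef_gt0)// exprn_ge0// ltW.
move=> x /andP[sx xt]; rewrite gamma_pdf_natE ?(lt_le_trans s0)//.
have c0 := gamma_coef_gt0.
apply: ler_pM; rewrite ?expR_ge0//.
- by rewrite mulr_ge0 ?(ltW c0)// exprn_ge0// ltW.
- by rewrite ler_pM2l// lerXn2r// nnegrE ltW// (lt_le_trans s0).
- by rewrite ler_expR lerN2 ler_pM2r ?invr_gt0.
Qed.

End law_nat.

(* Instead of evaluating incomplete Gamma integrals, the density of shape k + 1
   is compared with those of shapes 1 and 2k + 1, whose integrals are at most 1. *)
Lemma gamma_law_escape k l d0 d1 d2 (T0 : measurableType d0)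
    (T1 : measurableType d1) (T2 : measurableType d2)
    (P0 : probability T0 R) (P1 : probability T1 R) (P2 : probability T2 R)
    (X0 : {RV P0 >-> R}) (X2 : {RV P2 >-> R}) :
  has_gamma_law P0 1 l X0 -> has_gamma_law P2 (k + k).+1%:R l X2 ->
  exists2 C : R, 0 <= C & forall (X1 : {RV P1 >-> R}) (e : R),
    has_gamma_law P1 k.+1%:R l X1 -> 0 < e ->
    (P1 (X1 @^-1` (~` `]e, (e^-1)%R])) <= (C * e ^+ k)%:E)%E.
Proof.
move=> law0 law2; have c0 := @gamma_coef_gt0 _ _ _ _ 0 _ law0.
have c2 := gamma_coef_gt0 law2.
(* Ratios of normalizing constants. Below [e], [x ^+ k <= e ^+ k] compares with shape 1; above
   [e^-1], [1 <= (e * x) ^+ k] gives [x ^+ k <= e ^+ k * x ^+ (k + k)] and compares with shape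
   [2k + 1]. *)
pose C0 := gamma_coef k l / gamma_coef 0 l.
pose C2 := gamma_coef k l / gamma_coef (k + k) l.
have C00 : 0 <= C0 by rewrite divr_ge0 ?gamma_coef_ge0.
have C20 : 0 <= C2 by rewrite divr_ge0 ?gamma_coef_ge0.
exists (C0 + C2); first by rewrite addr_ge0.
move=> X1 e law1 e0; have c1 := gamma_coef_gt0 law1.
have ek0 : 0 < e ^+ k by rewrite exprn_gt0.
have -> : ~` [set` `]e, e^-1]] = [set` `]-oo, e]] `|` [set` `]e^-1, +oo[].
  apply/seteqP; split => x /=; rewrite !in_itv/= ?andbT.
    by move=> /negP; rewrite negb_and -leNgt -ltNge => /orP.
  by move=> xe; apply/negP; rewrite negb_and -leNgt -ltNge; apply/orP.
have mX (A : set R) : measurable A -> measurable (X1 @^-1` A).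
  exact: measurable_funPTI.
rewrite preimage_setU mulrDl EFinD.
apply: le_trans (measureU2 _ (mX _ _) (mX _ _)) _ => //.
apply: leeD.
- apply: (gamma_law_le law1 law0) => //; first by rewrite mulr_ge0// ltW.
  move=> x /=; rewrite in_itv/= => xe.
  have [x0|x0] := ltP 0 x; last by rewrite /gamma_pdf ltNge x0/= mulr0.
  rewrite (gamma_pdf_natE 0) ?gamma_pdf_natE// expr0 mulr1 !mulrA.
  rewrite ler_pM2r ?expR_gt0//.
  rewrite mulrAC /C0 -(mulrA _ _ (gamma_coef 0 l)) mulVf ?mulr1 ?gt_eqF//.
  by rewrite ler_pM2l// lerXn2r// nnegrE ltW.
- apply: (gamma_law_le law1 law2) => //; first by rewrite mulr_ge0// ltW.
  move=> x /=; rewrite in_itv/= andbT => xe.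
  have x0 : 0 < x by apply: lt_trans xe; rewrite invr_gt0.
  rewrite !gamma_pdf_natE// !mulrA ler_pM2r ?expR_gt0//.
  rewrite (mulrAC C2) /C2 -(mulrA _ _ (gamma_coef (k + k) l)) mulVf ?mulr1 ?gt_eqF//.
  rewrite -[leRHS]mulrA ler_pM2l// exprD mulrA -exprMn.
  rewrite ler_peMl ?exprn_ge0 ?(ltW x0)//.
  by rewrite exprn_ege1// -(mulfV (lt0r_neq0 e0)) ler_pM2l// ltW.
Qed.

End gamma_law.

(** * The law of [1 / alpha_hat] near its extreme points *)

Section sample.
Context {R : realType} {d : measure_display} {T : measurableType d}.
Context {P : probability T R} {n : nat} {X : 'I_n -> {RV P >-> R}}.

(** [E] contains the box with sides [B i], whose probability factors by independence. *)
Lemma mutually_independent_prob_ge (B : 'I_n -> set R) (p : 'I_n -> R) (E : set T) :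
  mutually_independent P X -> (forall i, measurable (B i)) -> measurable E ->
  (forall i, 0 <= p i) -> (forall i, ((p i)%:E <= P (X i @^-1` B i))%E) ->
  (forall t, (forall i, B i (X i t)) -> E t) ->
  ((\prod_i p i)%:E <= P E)%E.
Proof.
move=> indX mB mE p0 pB BE.
have mXB i : measurable (X i @^-1` B i) by exact: measurable_funPTI.
have fin i : P (X i @^-1` B i) \is a fin_num by exact: fin_num_measure.
apply: (@le_trans _ _ (P (\bigcap_(i in [set` [set: 'I_n]%SET]) X i @^-1` B i))).
  rewrite indX// (@eq_big _ _ _ _ _ _ xpredT _
    (fun i => (fine (P (X i @^-1` B i)))%:E)).
  - rewrite prodEFin lee_fin; apply: ler_prod => i _.
    by rewrite p0 -lee_fin fineK ?pB.
  - by move=> i; rewrite inE.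
  - by move=> i _; rewrite fineK.
apply: le_measure; rewrite ?inE//.
  apply: fin_bigcap_measurable => //; exact: finite_finset.
by move=> t XB; apply: BE => i; apply: XB; rewrite /= inE.
Qed.

Lemma measure_bigsetU_le (r : seq 'I_n) (A : 'I_n -> set T) (c : R) :
  (forall i, measurable (A i)) -> (forall i, (P (A i) <= c%:E)%E) ->
  (P (\big[setU/set0]_(i <- r) A i) <= ((size r)%:R * c)%:E)%E.
Proof.
move=> mA Ac; elim: r => [|i r IH]; first by rewrite big_nil measure0 mul0r.
rewrite big_cons /= -natr1 mulrDl mul1r addrC EFinD.
apply: le_trans (measureU2 _ _ _) _ => //; first exact: bigsetU_measurable.
by apply: leeD => //; exact: Ac.
Qed.

Hypothesis n_ge2 : (2 <= n)%N.

Let W : {RV P >-> R} := inv_alpha_hat X.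

Let mW (A : set R) : measurable A -> measurable (W @^-1` A).
Proof. exact: measurable_funPTI. Qed.

Section shape.
Context {k : nat} {l : R}.
Hypotheses (l_gt0 : 0 < l) (sX : gamma_sample P k.+1%:R l X).

Let lawX i : has_gamma_law P k.+1%:R l (X i). Proof. exact: sX.2. Qed.

Let c_gt0 : 0 < gamma_coef k l.
Proof. exact: gamma_coef_gt0 (lawX (Ordinal n_ge2)). Qed.

(** One coordinate is placed in [[1, 2]] and the other [n - 1] in [[h, 2h]] with [h] proportional to
    [e]; each of these costs [h ^+ k] for the density and [h] for the length. *)
Lemma ccdf_inv_alpha_hat_ge : exists2 c : R, 0 < c &
  forall e, 0 < e <= 1 ->
    ((c * e ^+ (k.+1 * n.-1))%:E <= ccdf W (n%:R - 1 - e))%E.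
Proof.
have n0 : 0 < n%:R :> R by rewrite ltr0n; case: n n_ge2.
have n1 : 1 <= n%:R :> R by rewrite ler1n; case: n n_ge2.
pose i0 := Ordinal n_ge2.
pose c0 := gamma_coef k l * expR (- (2 / l)).
pose c1 := gamma_coef k l * expR (- l^-1).
(* With [h = q * e], the loss [2 * n%:R ^+ 2 * (h + h)] of the near-axis bound is [e / 2], strictly
   below [e]. Also [h + h <= 1], whence the factor [expR (- l^-1)] in [c1]. *)
pose q : R := (8 * n%:R ^+ 2)^-1.
have q0 : 0 < q by rewrite invr_gt0 mulr_gt0 ?exprn_gt0.
have c00 : 0 < c0 by rewrite mulr_gt0 ?expR_gt0.
have c10 : 0 < c1 by rewrite mulr_gt0 ?expR_gt0.
exists (c0 * (c1 * q ^+ k.+1) ^+ n.-1).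
  by rewrite mulr_gt0 ?exprn_gt0// mulr_gt0 ?exprn_gt0.
move=> e /andP[e0 e1].
pose h := q * e.
have h0 : 0 < h by rewrite mulr_gt0.
have h1 : h + h <= 1.
  have : q <= 2^-1.
    rewrite lef_pV2 ?posrE// ?mulr_gt0 ?exprn_gt0//.
    have : 1 <= n%:R ^+ 2 :> R by rewrite exprn_ege1.
    lra.
  move=> q2; have : h <= 2^-1 * 1 by apply: ler_pM => //; exact: ltW.
  lra.
pose B i : set R := if i == i0 then [set` `[1, 2]] else [set` `[h, h + h]].
pose p i := if i == i0 then c0 else c1 * h ^+ k.+1.
have -> : c0 * (c1 * q ^+ k.+1) ^+ n.-1 * e ^+ (k.+1 * n.-1) = \prod_i p i.
  rewrite (bigD1 i0)//= {1}/p eqxx (eq_bigr (fun=> c1 * h ^+ k.+1)); last first.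
    by move=> i /negbTE ii; rewrite /p ii.
  rewrite prodr_const cardC1 card_ord -mulrA; congr (_ * _).
  by rewrite exprM -exprMn -mulrA -exprMn.
apply: (@mutually_independent_prob_ge B) => [|i||i|i|t Bt].
- exact: sX.1.
- by rewrite /B; case: ifP => _; exact: measurable_itv.
- exact: mW.
- by rewrite /p; case: ifP => _; rewrite ltW// mulr_gt0// exprn_gt0.
- rewrite /p /B; case: ifP => _.
    apply: le_trans (gamma_law_itv_ge (lawX i) l_gt0 ltr01 _); last by rewrite ltr1n.
    by rewrite expr1n mulr1 lee_fin ler_peMr ?(ltW c00)//; lra.
  apply: le_trans (gamma_law_itv_ge (lawX i) l_gt0 h0 _); last by rewrite ltrDl.
  rewrite lee_fin addrK exprSr [leLHS]mulrA ler_pM2r//.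
  rewrite [leRHS]mulrAC ler_pM2r ?exprn_gt0//.
  rewrite ler_pM2l// ler_expR lerN2 -[leRHS]mul1r ler_pM2r ?invr_gt0//.
- rewrite /= in_itv/= andbT.
  have := Bt i0; rewrite /B eqxx/= in_itv/= => /andP[X1 _].
  apply: lt_le_trans (inv_alpha_hat_ge_near_axis n_ge2 (addr_gt0 h0 h0) X1 _).
    rewrite ltrD2l ltrN2 /h /q.
    rewrite [ltLHS](_ : _ = e / 2); first by lra.
    by field; rewrite gt_eqF.
  move=> j /negbTE ji; have := Bt j; rewrite /B ji/= in_itv/=.
  by case/andP => /(le_trans (ltW h0)) -> ->.
Qed.

(** The last three clauses come from the positive orthant, from the cube [[1, 1 + e]^n] near the
    diagonal, and from the near-axis boxes of [ccdf_inv_alpha_hat_ge]. *)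
Lemma full_range_inv_alpha_hat : full_range (n%:R - 1) W.
Proof.
split.
- move=> x x0; rewrite /cdf /distribution /pushforward.
  rewrite [X in P X](_ : _ = set0) ?measure0//.
  apply/seteqP; split => t //=; rewrite in_itv/= => Wx.
  have := inv_alpha_hat_ge0 X t.
  by rewrite leNgt (le_lt_trans Wx).
- apply/eqP; rewrite eq_le cdf_le1/=.
  rewrite (_ : 1%E = (\prod_(i < n) (1 : R))%:E); last by rewrite big1.
  apply: (@mutually_independent_prob_ge (fun=> [set` `]0, +oo[]) (fun=> 1)) => //.
  + exact: sX.1.
  + exact: mW.
  + by move=> i; rewrite (gamma_law_gt0 (lawX i)).
  + move=> t Xt; rewrite /= in_itv/=; apply: inv_alpha_hat_le_pos => // i.
    by have := Xt i; rewrite /= in_itv/= andbT.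
- move=> e e0.
  pose c := gamma_coef k l * 1 ^+ k * expR (- ((1 + e) / l)) * (1 + e - 1).
  have c0 : 0 < c.
    rewrite /c addrAC subrr add0r expr1n mulr1.
    by rewrite mulr_gt0// mulr_gt0 ?expR_gt0.
  apply: (@lt_le_trans _ _ (\prod_(i < n) c)%:E).
    by rewrite lte_fin prodr_const exprn_gt0.
  apply: (@mutually_independent_prob_ge (fun=> [set` `[1, 1 + e]]) (fun=> c)) => //.
  + exact: sX.1.
  + exact: mW.
  + by move=> _; exact: ltW.
  + by move=> i; apply: gamma_law_itv_ge; rewrite ?ltrDl.
  + move=> t Xt; rewrite /= in_itv/=.
    by apply: inv_alpha_hat_le_near_diagonal.
- move=> e e0; have [c c0 hc] := ccdf_inv_alpha_hat_ge.
  pose e' := Num.min e 1.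
  have e'0 : 0 < e' by rewrite lt_min e0/=.
  apply: (@le_lt_trans _ _ (cdf W (n%:R - 1 - e'))).
    by apply: cdf_nondecreasing; rewrite lerD2l lerN2 ge_min lexx.
  have e'01 : 0 < e' <= 1 by rewrite e'0 ge_min lexx orbT.
  have := hc _ e'01; rewrite ccdf_1_cdf.
  have : (0 < (c * e' ^+ (k.+1 * n.-1))%:E)%E by rewrite lte_fin mulr_gt0 ?exprn_gt0.
  move=> /lt_le_trans /[apply]; rewrite sube_gt0//.
Qed.

End shape.

(** Contrapositive of [inv_alpha_hat_le_away_from_axes], followed by the union bound over the
    coordinates. *)
Lemma ccdf_inv_alpha_hat_le (e b : R) : 0 < e ->
  (forall i, (P (X i @^-1` (~` `]e, (e^-1)%R])) <= b%:E)%E) ->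
  (ccdf W (n%:R - 1 - e ^+ 2) <= (n%:R * b)%:E)%E.
Proof.
move=> e0 Xb.
have mX i : measurable (X i @^-1` (~` `]e, (e^-1)%R])).
  by apply: measurable_funPTI; apply: measurableC; exact: measurable_itv.
have := measure_bigsetU_le (enum 'I_n) mX Xb.
rewrite size_enum_ord; apply: le_trans.
rewrite /ccdf /distribution /pushforward; apply: le_measure; rewrite ?inE.
- exact: (mW (measurable_itv `]n%:R - 1 - e ^+ 2, +oo[)).
- exact: bigsetU_measurable.
move=> t /=; rewrite in_itv/= andbT; apply: contraPP => /= nX.
apply/negP; rewrite -leNgt; apply: inv_alpha_hat_le_away_from_axes => // i.
apply: contrapT => Xi; apply: nX.
rewrite -bigcup_seq; exists i => /=; first by rewrite mem_enum.
by rewrite in_itv.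
Qed.

End sample.

(** * Comparison of the shapes 1 and [2n] *)

Theorem theorem2 (R : realType) (n : nat) (l : R)
    (d : {posnum R} -> measure_display)
    (T : forall a : {posnum R}, measurableType (d a))
    (P : forall a : {posnum R}, probability (T a) R)
    (X : forall a : {posnum R}, 'I_n -> {RV (P a) >-> R}) :
  (2 <= n)%N -> 0 < l ->
  (forall a : {posnum R}, gamma_sample (P a) a%:num l (X a)) ->
  ~ disp_increasing P (fun a : {posnum R} => inv_alpha_hat (X a)) /\
  ~ disp_decreasing P (fun a : {posnum R} => inv_alpha_hat (X a)).
Proof.
move=> n2 l0 sX.
(* [a j] is the shape [j + 1], so [a k] is [2n]. The choice of [k] gives [e ^+ k] one factor [e]
   more than [(e ^+ 2) ^+ n.-1], the order reached at shape 1. *)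
pose a j : {posnum R} := PosNum (ltr0Sn R j).
pose k := (2 * n.-1).+1.
have sa j : gamma_sample (P (a j)) j.+1%:R l (X (a j)) by exact: sX.
have f0 := full_range_inv_alpha_hat n2 l0 (sa 0%N).
have fk := full_range_inv_alpha_hat n2 l0 (sa k).
have a0k : (a 0%N)%:num < (a k)%:num by rewrite /= ltr_nat.
pose W j : {RV P (a j) >-> R} := inv_alpha_hat (X (a j)).
suff neq : ~ (forall u, 0 < u < 1 -> quantile (W 0%N) u = quantile (W k) u).
  split=> mono; apply: neq => u u01.
    exact: (disp_le_quantile_eq f0 fk (mono _ _ a0k)).
  by rewrite -[LHS](disp_le_quantile_eq fk f0 (mono _ _ a0k)).
move=> eqQ; have cdf_le := quantile_eq_cdf_le f0 fk eqQ.
have [c c0 ccdf0] := ccdf_inv_alpha_hat_ge n2 l0 (sa 0%N).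
pose i0 := Ordinal n2.
(* The auxiliary laws of shapes 1 and [2k + 1] are taken from the given family of samples. *)
have [C C0 escape] := gamma_law_escape (P (a k))
  ((sa 0%N).2 i0) ((sa (k + k)%N).2 i0).
(* Absorbs the halving of [e ^+ 2] in [lower], which creates the strict gap between thresholds that
   [cdf_le] requires. *)
pose c' := c / 2 ^+ n.-1.
have c'0 : 0 < c' by rewrite divr_gt0 ?exprn_gt0.
have nC0 : 0 <= n%:R * C by rewrite mulr_ge0.
have [e /andP[e0 e1] eC] : exists2 e, 0 < e <= 1 & n%:R * C * e < c'.
  have D0 : 0 < n%:R * C + c' by rewrite ltr_wpDl.
  (* Adding [c'] to the denominator keeps it positive when [C] is 0 and makes the quotient at most
     1. *)
  exists (c' / (n%:R * C + c')).
    by rewrite divr_gt0//= ler_pdivrMr// mul1r lerDr.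
  by rewrite mulrA ltr_pdivrMr// mulrDr mulrC ltrDl mulr_gt0.
have e21 : e ^+ 2 <= 1 by rewrite exprn_ile1// ltW.
have e20 : 0 < e ^+ 2 by rewrite exprn_gt0.
have lower : ((c' * e ^+ (2 * n.-1))%:E <=
    ccdf (W 0%N) (n%:R - 1 - e ^+ 2 / 2))%E.
  have -> : c' * e ^+ (2 * n.-1) = c * (e ^+ 2 / 2) ^+ (1 * n.-1).
    by rewrite mul1n expr_div_n exprM mulrA mulrAC.
  by apply: ccdf0; apply/andP; split; lra.
have upper : (ccdf (W k) (n%:R - 1 - e ^+ 2) <=
    (n%:R * (C * e ^+ k))%:E)%E.
  by apply: ccdf_inv_alpha_hat_le => // i; apply: escape => //; exact: (sa k).2.
have : (c' * e ^+ (2 * n.-1) <= n%:R * (C * e ^+ k))%R.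
  rewrite -lee_fin; apply: le_trans lower (le_trans _ upper).
  by rewrite !ccdf_1_cdf leeB//; apply: cdf_le; lra.
by apply/negP; rewrite -ltNge exprS !mulrA ltr_pM2r ?exprn_gt0.
Qed.
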